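(* Let $G=(V,E)$ be a finite graph (undirected or directed, without loops) with $V=\{1,\dots,n\}$, let $\mathcal C$ be a storage code on $G$ over a finite alphabet $Q$ with $|Q|=q\ge 2$, fix a proper coloring of $G$ and, for each color, a matrix from a family of orthogonal partitions of shape $(k,s)$ (distinct colors receiving distinct matrices), and let $\bar G$ and $\bar{\mathcal C}$ be the resulting interleaved graph and interleaved code. Then $\mathcal R_{q^k}(\bar{\mathcal C})=\mathcal R_q(\mathcal C)$, and thus $\mathsf{cap}_{q^k}(\bar G)\ge \mathsf{cap}_q(G)$.
   Context: Storage codes: for a finite graph $G=(V,E)$ with $|V|=n$ put $N(v)=\{u:(v,u)\in E\}$. A storage code on $G$ over an alphabet $Q$ of size $q$ is a nonempty set $\mathcal C\subseteq Q^V$ such that for each $v\in V$ there is a function $f_v$ with $x_v=f_v((x_u)_{u\in N(v)})$ for all $x\in\mathcal C$. Its rate is $\mathcal R_q(\mathcal C)=\frac1n\log_q|\mathcal C|$, and $\mathsf{cap}_q(G)$ is the largest rate of a storage code on $G$ over an alphabet of size $q$. Orthogonal partitions: let $s\ge k\ge 1$. A set $\mathcal M$ of $k\times s$ matrices over $\mathbb N$ is a family of orthogonal partitions of $\{1,\dots,ks\}$ of shape $(k,s)$ if (1) every $A\in\mathcal M$ contains every element of $\{1,\dots,ks\}$ exactly once; (2) for all distinct $A,B\in\mathcal M$, every column of $A$ has common entries with exactly $k$ columns of $B$, and every such pair of intersecting columns has exactly one common element. Interleaved graph: fix a coloring $c(\cdot)$ of $V$ with colors $1,\dots,c$ such that adjacent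 vertices have different colors, and distinct matrices $M_1,\dots,M_c\in\mathcal M$. The graph $\bar G=(\bar V,\bar E)$ has $\bar V=\{1,\dots,n\}\times\{1,\dots,s\}$ and $((t,\mu),(t',\mu'))\in\bar E$ if and only if $(t,t')\in E$ and column $\mu$ of $M_{c(t)}$ intersects column $\mu'$ of $M_{c(t')}$ (as sets of entries). Interleaved code: for any (not necessarily distinct) $x^1,\dots,x^{ks}\in\mathcal C$, let $\bar x\in (Q^k)^{\bar V}$ be the word that assigns to the vertex $(t,\mu)$ the vector $\bigl(x_t^{M_{c(t)}(1,\mu)},\dots,x_t^{M_{c(t)}(k,\mu)}\bigr)\in Q^k$. The code $\bar{\mathcal C}$ (over the alphabet $Q^k$ of size $q^k$, of length $ns$) is the set of all words $\bar x$ obtained as $(x^1,\dots,x^{ks})$ ranges over $\mathcal C^{ks}$. *)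

(* Defs.v *)
From HB Require Import structures.
From mathcomp Require Import all_boot all_order all_algebra.
From mathcomp Require Import finmap.
From mathcomp Require Import boolp classical_sets reals exp.

Set Implicit Arguments.
Unset Strict Implicit.
Unset Printing Implicit Defensive.

Import Order.TTheory GRing.Theory Num.Theory.

Local Open Scope ring_scope.

(* A loopless directed graph on V is an irreflexive [e : rel V], where [e v u]
   means (v, u) \in E; an undirected graph is the case where [e] is
   symmetric. *)

Definition storage_code (V Q : finType) (e : rel V)
    (C : {set {ffun V -> Q}}) : Prop :=
  (exists x, x \in C) /\
  forall v : V, exists f : {ffun {u : V | e v u} -> Q} -> Q,
    forall x : {ffun V -> Q}, x \in C -> x v = f [ffun u => x (val u)].

Definition log_base (R : realType) (b x : R) : R := ln x / ln b.

Definition rate (R : realType) (q : nat) (V Q : finType)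
    (C : {set {ffun V -> Q}}) : R :=
  #|V|%:R^-1 * log_base q%:R #|C|%:R.

Definition storage_rates (R : realType) (q : nat) (V : finType) (e : rel V) :
    set R :=
  [set r | exists (Q : finType) (C : {set {ffun V -> Q}}),
     [/\ #|Q| = q, storage_code e C & r = rate R q C] ]%classic.
Arguments storage_rates R q {V} e _.

Definition cap (R : realType) (q : nat) (V : finType) (e : rel V) : R :=
  sup (storage_rates R q e).

(* The supremum defining [cap] is attained, so [cap] is the largest rate. *)
Lemma cap_is_max (R : realType) (q : nat) (V : finType) (e : rel V) :
  (0 < q)%N ->
  storage_rates R q e (cap R q e) /\
  (forall r : R, storage_rates R q e r -> r <= cap R q e).
Proof.
case: q => // q _; set S := storage_rates R q.+1 e.
pose N := #|{ffun V -> 'I_q.+1}|.+1.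
pose f (i : 'I_N) : R := #|V|%:R^-1 * log_base q.+1%:R i%:R.
have SfP r : S r -> exists2 i, r = f i & S (f i).
  move=> [Q [C [cQ sC rE]]].
  have ltN : (#|C| < N)%N.
    by rewrite ltnS (leq_trans (max_card _)) // !card_ffun cQ card_ord.
  by exists (Ordinal ltN); [rewrite rE | exists Q, C; rewrite -rE].
have [r0 Sr0] : exists r, S r.
  exists (rate R q.+1 [set x : {ffun V -> 'I_q.+1} | x == [ffun=> ord0]]%SET).
  exists 'I_q.+1, [set x : {ffun V -> 'I_q.+1} | x == [ffun=> ord0]]%SET.
  split; rewrite ?card_ord //; split; first by exists [ffun=> ord0]; rewrite inE.
  by move=> v; exists (fun=> ord0) => x; rewrite inE => /eqP->; rewrite ffunE.
have [i0 _ Si0] := SfP _ Sr0.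
have /asboolT Pi0 := Si0.
case: (@Order.TotalTheory.arg_maxP _ _ _ i0 (fun i => `[< S (f i) >]) f Pi0).
move=> i /asboolP Si max_i.
have ubS r : S r -> r <= f i.
  by move=> /SfP[j -> Sj]; apply/max_i/asboolP.
suff -> : cap R q.+1 e = f i by [].
apply/eqP; rewrite eq_le; apply/andP; split.
  by apply: ge_sup; [exists r0 | move=> r; exact: ubS].
by apply: ub_le_sup => //; exists (f i) => r; exact: ubS.
Qed.

Definition column_set (k s : nat) (A : 'M[nat]_(k, s)) (mu : 'I_s) :
    {fset nat} :=
  [fset A i mu | i in 'I_k]%fset.

Definition common_entries (k s : nat) (A B : 'M[nat]_(k, s)) (mu nu : 'I_s) :
    {fset nat} :=
  (column_set A mu `&` column_set B nu)%fset.

Definition columns_meet (k s : nat) (A B : 'M[nat]_(k, s)) (mu nu : 'I_s) :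
    bool :=
  common_entries A B mu nu != fset0.

(* The entries are the numbers 1, ..., k * s. *)
Definition orthogonal_partitions (k s : nat) (F : set 'M[nat]_(k, s)) : Prop :=
  (forall A, F A -> forall m : nat, (1 <= m <= k * s)%N ->
     #|[pred p : 'I_k * 'I_s | A p.1 p.2 == m]| = 1%N) /\
  (forall A B, F A -> F B -> A <> B -> forall mu : 'I_s,
     #|[pred nu : 'I_s | columns_meet A B mu nu]| = k /\
     (forall nu : 'I_s, columns_meet A B mu nu ->
        #|` common_entries A B mu nu| = 1%N)).

Definition proper_coloring (V : finType) (e : rel V) (c : nat)
    (col : V -> 'I_c) : Prop :=
  forall v u : V, e v u -> col v <> col u.

Definition interleaved_graph (V : finType) (e : rel V) (c k s : nat)
    (col : V -> 'I_c) (M : 'I_c -> 'M[nat]_(k, s)) : rel (V * 'I_s) :=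
  fun a b => e a.1 b.1 &&
    columns_meet (M (col a.1)) (M (col b.1)) a.2 b.2.

(* The words x^1, ..., x^{ks} are given by x : nat -> Q^V, of which only the
   values at 1, ..., k * s matter: these are the entries of the matrices. *)
Definition interleaved_word (V Q : finType) (c k s : nat)
    (col : V -> 'I_c) (M : 'I_c -> 'M[nat]_(k, s))
    (x : nat -> {ffun V -> Q}) : {ffun V * 'I_s -> {ffun 'I_k -> Q}} :=
  [ffun a => [ffun i => x (M (col a.1) i a.2) a.1]].

Definition interleaved_code (V Q : finType) (c k s : nat)
    (col : V -> 'I_c) (M : 'I_c -> 'M[nat]_(k, s))
    (C : {set {ffun V -> Q}}) : {set {ffun V * 'I_s -> {ffun 'I_k -> Q}}} :=
  [set y | `[< exists x : nat -> {ffun V -> Q},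
                 (forall j : nat, (1 <= j <= k * s)%N -> x j \in C) /\
                 y = interleaved_word col M x >] ]%SET.

(* Main.v *)
(** Every number in 1, ..., ks sits in exactly one cell of each matrix, so for
each vertex t the coordinates of the interleaved word at (t, 1), ..., (t, s)
list x^1_t, ..., x^{ks}_t in some order. Hence the word determines
(x^1, ..., x^{ks}), the interleaved code has |C|^{ks} words, and the rate is
unchanged. For recovery at (t, mu), let m be an entry of column mu of M_{c(t)}.
For each neighbour u of t, the column of M_{c(u)} that contains m meets column
mu, so the neighbours of (t, mu) reveal x^m on N(t), hence x^m_t. *)

Require Import Defs.
From mathcomp Require Import all_boot all_order all_algebra.
From mathcomp Require Import boolp classical_sets reals.
From mathcomp Require Import finmap exp.

Import Order.TTheory GRing.Theory Num.Theory.

Local Open Scope ring_scope.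

(** Trades the recovery functions for a condition on pairs of codewords. Conversely, a recovery
    function looks up any codeword with the given restriction to the neighbours of [v]; the choice
    does not affect its symbol at [v]. *)
Lemma storage_codeP (V Q : finType) (e : rel V) (C : {set {ffun V -> Q}}) :
  storage_code e C <->
  (exists x, x \in C) /\
  (forall (v : V) (x y : {ffun V -> Q}), x \in C -> y \in C ->
     (forall u, e v u -> x u = y u) -> x v = y v).
Proof.
split=> -[[x0 x0C] recC]; split; try by exists x0.
  move=> v x y xC yC exy; have [f fP] := recC v.
  rewrite (fP x xC) (fP y yC); congr (f _).
  by apply/ffunP => u; rewrite !ffunE exy ?(valP u).
move=> v; pose restr (x : {ffun V -> Q}) : {ffun {u : V | e v u} -> Q} :=
  [ffun u => x (val u)].
(* The default [x0] serves only those [g] that no codeword restricts to. *)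
exists (fun g => odflt x0 [pick x in C | restr x == g] v) => x xC.
case: pickP => [y /andP[yC /eqP/ffunP eyx] | /(_ x)]; last first.
  by rewrite xC eqxx.
apply: recC => // u vu.
by have := eyx (Sub u vu); rewrite !ffunE SubK => ->.
Qed.

Definition fills {k s : nat} (A : 'M[nat]_(k, s)) : Prop :=
  forall m : nat, (1 <= m <= k * s)%N ->
    #|[pred p : 'I_k * 'I_s | A p.1 p.2 == m]| = 1%N.

Section Fills.

Context {k s : nat} {A : 'M[nat]_(k, s)} (fillA : fills A).

Lemma fills_cell m : (1 <= m <= k * s)%N -> exists i mu, A i mu = m.
Proof.
move=> /fillA cardm.
have /card_gt0P[[i mu]] : (0 < #|[pred p : 'I_k * 'I_s | A p.1 p.2 == m]|)%N.
  by rewrite cardm.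
by rewrite inE => /eqP <-; exists i, mu.
Qed.

(** By counting: the numbers 1, ..., [k * s] occupy distinct cells, and there are only [k * s]
    cells, so no cell is left for another value. *)
Lemma fills_range i mu : (1 <= A i mu <= k * s)%N.
Proof.
have cellP (m : 'I_(k * s)) : exists p : 'I_k * 'I_s, A p.1 p.2 == m.+1.
  have [|i' [mu' <-]] := fills_cell m.+1; first by rewrite ltn_ord.
  by exists (i', mu').
pose cell m := xchoose (cellP m).
have cellE m : A (cell m).1 (cell m).2 = m.+1.
  exact/eqP/(xchooseP (cellP m)).
have cell_inj : injective cell.
  move=> m1 m2 /(congr1 (fun p => A p.1 p.2)).
  by rewrite !cellE => -[/val_inj].
have [|cell' _ cellK] := inj_card_bij cell_inj.
  by rewrite card_prod !card_ord.
by have := cellE (cell' (i, mu)); rewrite cellK /= => ->; rewrite ltn_ord.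
Qed.

End Fills.

Lemma columns_meet_common {k s : nat} {A B : 'M[nat]_(k, s)} {i mu j nu} :
  A i mu = B j nu -> columns_meet A B mu nu.
Proof.
move=> eAB; apply/fset0Pn; exists (A i mu).
rewrite in_fsetI; apply/andP; split; apply/imfsetP; first by exists i.
by exists j.
Qed.

Section Interleaving.

Context {V Q : finType} {c k s : nat} {col : V -> 'I_c}.
Context {M : 'I_c -> 'M[nat]_(k, s)} (fillM : forall i, fills (M i)).

Local Notation word := (interleaved_word col M).

Lemma interleaved_word_inj (x y : nat -> {ffun V -> Q}) :
  word x = word y -> forall m, (1 <= m <= k * s)%N -> x m = y m.
Proof.
move=> exy m m_range; apply/ffunP => t.
have [i [mu Em]] := fills_cell (fillM (col t)) m m_range.
by have /ffunP/(_ (t, mu))/[!ffunE]/ffunP/(_ i) := exy; rewrite !ffunE /= Em.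
Qed.

Lemma eq_interleaved_word (x y : nat -> {ffun V -> Q}) :
  (forall m, (1 <= m <= k * s)%N -> x m = y m) -> word x = word y.
Proof.
move=> exy; apply/ffunP => a; rewrite !ffunE; apply/ffunP => i; rewrite !ffunE.
by rewrite exy // fills_range.
Qed.

Lemma card_interleaved_code (C : {set {ffun V -> Q}}) :
  (exists x, x \in C) -> #|interleaved_code col M C| = (#|C| ^ (k * s))%N.
Proof.
move=> [x0 _].
(* Sequences over [nat] are replaced by finite families so that they can be counted. Index [j]
   stands for word number [j.+1]; values outside 1, ..., [k * s] are immaterial. *)
pose fam (g : {ffun 'I_(k * s) -> {ffun V -> Q}}) (m : nat) :=
  if insub m.-1 is Some j then g j else x0.
have famE g (j : 'I_(k * s)) : fam g j.+1 = g j by rewrite /fam /= valK.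
have -> : interleaved_code col M C = [set word (fam g) | g in ffun_on (mem C)].
  apply/setP => y; rewrite inE; apply/asboolP/imsetP => [[x [xC ->]] | ].
    exists [ffun j : 'I_(k * s) => x j.+1].
      by apply/ffun_onP => j; rewrite ffunE xC ?ltn_ord.
    apply: eq_interleaved_word => -[//|m] m_lt.
    by rewrite (famE _ (Ordinal m_lt)) ffunE.
  move=> [g /ffun_onP gC ->]; exists (fam g); split=> // -[//|m] m_lt.
  by rewrite (famE _ (Ordinal m_lt)) gC.
rewrite card_imset ?card_ffun_on ?card_ord // => g h egh.
apply/ffunP => j; rewrite -!famE.
by apply: interleaved_word_inj egh _ _; rewrite ltn_ord.
Qed.

(** The exponent [k * s] in the number of codewords cancels the factor [s] of the length and the
    factor [k] of [ln (q ^ k)]. *)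
Lemma rate_interleaved_code (R : realType) (q : nat) (C : {set {ffun V -> Q}}) :
  (1 < q)%N -> (0 < k)%N -> (0 < s)%N -> (exists x, x \in C) ->
  rate R (q ^ k)%N (interleaved_code col M C) = rate R q C.
Proof.
move=> q_gt1 k_gt0 s_gt0 C_neq0; rewrite /rate /log_base.
rewrite card_interleaved_code // card_prod card_ord.
have C_gt0 : (0 < #|C|)%N by case: C_neq0 => x xC; apply/card_gt0P; exists x.
have ln_natX (a b : nat) : (0 < a)%N -> ln (a ^ b)%:R = b%:R * ln a%:R :> R.
  by move=> a_gt0; rewrite natrX lnXn ?ltr0n // mulr_natl.
rewrite !ln_natX ?(ltnW q_gt1) // !natrM.
have k_neq0 : k%:R != 0 :> R by rewrite pnatr_eq0 -lt0n.
have s_neq0 : s%:R != 0 :> R by rewrite pnatr_eq0 -lt0n.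
rewrite !invfM -!mulrA; congr (_ * _).
by rewrite [k%:R * _]mulrCA mulKf // [ln _ * _]mulrCA mulVKf.
Qed.

Lemma interleaved_storage_code (e : rel V) (C : {set {ffun V -> Q}}) :
  storage_code e C ->
  storage_code (interleaved_graph e col M) (interleaved_code col M C).
Proof.
move=> /storage_codeP[[x0 x0C] recC]; apply/storage_codeP; split.
  by exists (word (fun=> x0)); rewrite inE; apply/asboolP; exists (fun=> x0).
move=> [t mu] _ _ /[!inE] /asboolP[x [xC ->]] /asboolP[y [yC ->]] exy.
rewrite !ffunE; apply/ffunP => i; rewrite !ffunE /=.
(* Row [i] at [(t, mu)] involves only the words numbered [M (col t) i mu], so recovery in [C]
   applies to these two words. *)
have m_range := fills_range (fillM (col t)) i mu.
apply: recC => [||u tu]; [exact: xC | exact: yC |].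
have [j [nu Em]] := fills_cell (fillM (col u)) _ m_range.
(* The two columns share that number, so [(u, nu)] is a neighbour, and its row [j] holds the symbol
   at [u] of the same word. *)
have : interleaved_graph e col M (t, mu) (u, nu).
  by rewrite /interleaved_graph tu; apply: columns_meet_common (esym Em).
by move=> /exy/[!ffunE]/ffunP/(_ j); rewrite !ffunE /= Em.
Qed.

End Interleaving.

Theorem proposition3p3 (R : realType) (n : nat) (e : rel 'I_n)
    (e_loopless : irreflexive e)
    (q : nat) (q_ge2 : (2 <= q)%N) (Q : finType) (card_Q : #|Q| = q)
    (C : {set {ffun 'I_n -> Q}}) (C_storage : storage_code e C)
    (k s : nat) (k_ge1 : (1 <= k)%N) (k_le_s : (k <= s)%N)
    (F : set 'M[nat]_(k, s)) (F_orth : orthogonal_partitions F)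
    (c : nat) (col : 'I_n -> 'I_c) (col_proper : proper_coloring e col)
    (M : 'I_c -> 'M[nat]_(k, s)) (M_in_F : forall i : 'I_c, F (M i))
    (M_distinct : injective M) :
  rate R (q ^ k)%N (interleaved_code col M C) = rate R q C /\
  cap R (q ^ k)%N (interleaved_graph e col M) >= cap R q e.
Proof.
have fillM i : fills (M i) by apply: F_orth.1.
have s_gt0 : (0 < s)%N := leq_trans k_ge1 k_le_s.
have q_gt0 : (0 < q)%N := ltnW q_ge2.
split; first by apply: rate_interleaved_code => //; case: C_storage.
(* An optimal code [C'] is interleaved in place of [C]; its alphabet [Q'] may differ from [Q]. *)
have [[Q' [C' [cardQ' C'_storage ->]]] _] := cap_is_max R e q_gt0.
have qk_gt0 : (0 < q ^ k)%N by rewrite expn_gt0 q_gt0.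
apply: (cap_is_max R _ qk_gt0).2.
exists {ffun 'I_k -> Q'}, (interleaved_code col M C'); split.
- by rewrite card_ffun card_ord cardQ'.
- exact: interleaved_storage_code.
- by rewrite rate_interleaved_code //; case: C'_storage.
Qed.
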